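(* For a $T_0$ space $X$, the following conditions are equivalent: (1) $X$ is well-filtered. (2) The upper Vietoris topology is coarser than the Scott topology on $\mathsf{K}(X)$ (i.e. $\mathcal O(P_S(X))\subseteq\sigma(\mathsf{K}(X))$), and $\Sigma\,\mathsf{K}(X)$ is well-filtered. (3) The upper Vietoris topology is coarser than the Scott topology on $\mathsf{K}(X)$, and $\Sigma\,\mathsf{K}(X)$ is a $d$-space. (4) $\mathsf{K}(X)$ is a dcpo, and the upper Vietoris topology is coarser than the Scott topology on $\mathsf{K}(X)$.
   Context: ''Coarser'' allows equality. A subset of a $T_0$ space $X$ is saturated if it equals the intersection of all open sets containing it (equivalently, it is an upper set in the specialization order $x\le y \iff x\in\overline{\{y\}}$). $\mathsf{K}(X)$ denotes the set of all nonempty compact saturated subsets of $X$, ordered by the Smyth order $K_1\sqsubseteq K_2 \iff K_2\subseteq K_1$. The upper Vietoris topology on $\mathsf{K}(X)$ has base $\{\Box U: U \text{ open in } X\}$, where $\Box U=\{K\in\mathsf{K}(X):K\subseteq U\}$; the resulting space is denoted $P_S(X)$ and $\mathcal O(P_S(X))$ is its topology. For a poset $P$, a subset $U$ is Scott open if $U$ is an upper set and for every (nonempty) directed $D\subseteq P$ whose supremum $\bigvee D$ exists in $P$, $\bigvee D\in U$ implies $D\cap U\neq\emptyset$; these sets form the Scott topology $\sigma(P)$, and $\Sigma P=(P,\sigma(P))$. The Scott power space of $X$ is $\Sigma\,\mathsf{K}(X)=(\mathsf{K}(X),\sigma(\mathsf{K}(X)))$. A poset is a dcpo if every nonempty directed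 subset has a supremum. A $T_0$ space is a $d$-space if it is a dcpo in its specialization order and each open set is Scott open for that order. A $T_0$ space $X$ is well-filtered if for every filtered family $\mathcal K\subseteq \mathsf{K}(X)$ (nonempty, any two members contain a common third member) and every open $U$, $\bigcap\mathcal K\subseteq U$ implies $K\subseteq U$ for some $K\in\mathcal K$. *)

(* Defs.v *)
From HB Require Import structures.
From mathcomp Require Import all_boot all_order.
From mathcomp Require Import all_classical.
From mathcomp Require Import topology.

Set Implicit Arguments.
Unset Strict Implicit.
Unset Printing Implicit Defensive.

Import Order.TTheory.

Local Open Scope classical_set_scope.
Local Open Scope order_scope.

Section Posets.
Context {d : Order.disp_t} {P : porderType d}.

Definition directed (D : set P) : Prop :=
  D !=set0 /\
  forall x y, D x -> D y -> exists z, [/\ D z, x <= z & y <= z].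

Definition upper_set (U : set P) : Prop := forall x y, x <= y -> U x -> U y.

(* The hypothesis [supremums D s] says that the supremum of D exists and is s;
   directed sets without a supremum impose no condition. *)
Definition scott_open (U : set P) : Prop :=
  upper_set U /\
  forall (D : set P) (s : P),
    directed D -> supremums D s -> U s -> D `&` U !=set0.

Lemma scott_openT : scott_open setT.
Proof. by split => // D s [[x Dx] _] _ _; exists x. Qed.

Lemma scott_openI : setI_closed scott_open.
Proof.
move=> U V [uU sU] [uV sV]; split.
  by move=> x y xy [Ux Vx]; split; [exact: uU xy Ux | exact: uV xy Vx].
move=> D s dD Ds [Us Vs].
have [x [Dx Ux]] := sU D s dD Ds Us; have [y [Dy Vy]] := sV D s dD Ds Vs.
have [z [Dz xz yz]] := dD.2 x y Dx Dy.
by exists z; split=> //; split; [exact: uU xz Ux | exact: uV yz Vy].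
Qed.

Lemma scott_open_bigU (I : Type) (f : I -> set P) :
  (forall i, scott_open (f i)) -> scott_open (\bigcup_i f i).
Proof.
move=> sf; split.
  by move=> x y xy [i _ fx]; exists i => //; exact: (sf i).1 xy fx.
move=> D s dD Ds [i _ fs]; have [x [Dx fx]] := (sf i).2 D s dD Ds fs.
by exists x; split=> //; exists i.
Qed.

End Posets.

Definition dcpo {d : Order.disp_t} (P : porderType d) : Prop :=
  forall D : set P, directed D -> supremums D !=set0.

Definition scott_space {d : Order.disp_t} (P : porderType d) : Type := P.

HB.instance Definition _ {d : Order.disp_t} (P : porderType d) :=
  Choice.on (scott_space P).
HB.instance Definition _ {d : Order.disp_t} (P : porderType d) :=
  isOpenTopological.Build (scott_space P)
    (@scott_openT d P) (@scott_openI d P) (@scott_open_bigU d P).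

Lemma open_scottE {d : Order.disp_t} (P : porderType d) :
  @open (scott_space P) = @scott_open d P.
Proof. by []. Qed.

(* X with its specialization order; the proof that X is T0 is an argument of
   the alias because it gives antisymmetry. *)
Definition specialization (X : topologicalType) (X0 : kolmogorov_space X) :
  Type := X.

Section Specialization.
Context {X : topologicalType} (X0 : kolmogorov_space X).
Local Notation S := (specialization X0).

Definition spec_le (x y : S) : bool := `[< closure [set (y : X)] (x : X) >].

Lemma spec_leP (x y : S) :
  spec_le x y <-> (forall A : set X, nbhs (x : X) A -> A (y : X)).
Proof.
split=> [/asboolP xy A Ax|xy]; first by case: (xy A Ax) => z [] ->.
by apply/asboolP => A Ax; exists y; split=> //; exact: xy.
Qed.

Lemma spec_le_refl : reflexive spec_le.
Proof. by move=> x; apply/spec_leP => A /nbhs_singleton. Qed.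

Lemma spec_le_anti : antisymmetric spec_le.
Proof.
move=> x y /andP[/spec_leP xy /spec_leP yx].
apply/eqP/negPn/negP => /(X0 (x := x) (y := y)) [A [] []].
- by rewrite inE => /xy Ay; rewrite inE => /(_ Ay).
- by rewrite inE => /yx Ax; rewrite inE => /(_ Ax).
Qed.

Lemma spec_le_trans : transitive spec_le.
Proof.
move=> y x z /spec_leP xy /spec_leP yz; apply/spec_leP => A.
rewrite nbhsE => -[B [oB Bx] BA]; apply: BA; apply: yz.
have By : B y by apply: xy; exact: open_nbhs_nbhs.
exact: open_nbhs_nbhs.
Qed.

End Specialization.

Fact specialization_display : Order.disp_t. Proof. exact: Order.Disp tt tt. Qed.

HB.instance Definition _ (X : topologicalType) (X0 : kolmogorov_space X) :=
  Choice.on (specialization X0).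
HB.instance Definition _ (X : topologicalType) (X0 : kolmogorov_space X) :=
  Order.Le_isPOrder.Build specialization_display (specialization X0)
    (spec_le_refl (X0 := X0)) (spec_le_anti (X0 := X0))
    (spec_le_trans (X0 := X0)).

Definition d_space (X : topologicalType) : Prop :=
  exists X0 : kolmogorov_space X,
    dcpo (specialization X0) /\
    forall U : set X, open U -> scott_open (U : set (specialization X0)).

Definition saturated (X : topologicalType) (A : set X) : Prop :=
  A = \bigcap_(U in [set U : set X | open U /\ A `<=` U]) U.

(* K(X) in the literature. *)
Record compact_saturated (X : topologicalType) : Type := CompactSaturated {
  cs_set :> set X;
  cs_nonempty : cs_set !=set0;
  cs_compact : compact cs_set;
  cs_saturated : saturated cs_set }.

HB.instance Definition _ (X : topologicalType) :=
  gen_eqMixin (compact_saturated X).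
HB.instance Definition _ (X : topologicalType) :=
  gen_choiceMixin (compact_saturated X).

Section Smyth.
Context {X : topologicalType}.
Implicit Types K L : compact_saturated X.

Lemma cs_inj K L : K = L :> set X -> K = L.
Proof.
case: K L => [A a1 a2 a3] [B b1 b2 b3] /= AB; rewrite -{}AB in b1 b2 b3 *.
by congr CompactSaturated; exact: Prop_irrelevance.
Qed.

Definition smyth_le K L : bool := `[< (L : set X) `<=` (K : set X) >].

Lemma smyth_le_refl : reflexive smyth_le.
Proof. by move=> K; apply/asboolP. Qed.

Lemma smyth_le_anti : antisymmetric smyth_le.
Proof.
by move=> K L /andP[/asboolP KL /asboolP LK]; apply/cs_inj/seteqP; split.
Qed.

Lemma smyth_le_trans : transitive smyth_le.
Proof.
move=> L K M /asboolP LK /asboolP ML.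
by apply/asboolP; exact: subset_trans ML LK.
Qed.

End Smyth.

Fact smyth_display : Order.disp_t. Proof. exact: Order.Disp tt tt. Qed.

HB.instance Definition _ (X : topologicalType) :=
  Order.Le_isPOrder.Build smyth_display (compact_saturated X)
    (@smyth_le_refl X) (@smyth_le_anti X) (@smyth_le_trans X).

(* P_S(X): K(X) retopologized through an alias, so that it does not clash with
   the Scott topology on the same points. *)
Definition smyth_power_space (X : topologicalType) : Type :=
  compact_saturated X.

Section UpperVietoris.
Context {X : topologicalType}.

Definition box (U : set X) : set (smyth_power_space X) :=
  [set K : compact_saturated X | (K : set X) `<=` U].

Lemma box_cover : \bigcup_(U in (open : set (set X))) box U = setT.
Proof.
by apply/seteqP; split=> // K _; exists setT => //; exact: openT.
Qed.

Lemma box_join (U V : set X) (K : smyth_power_space X) :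
  open U -> open V -> box U K -> box V K ->
  exists W : set X, [/\ open W, box W K & box W `<=` box U `&` box V].
Proof.
move=> oU oV UK VK; exists (U `&` V); split; first exact: openI.
- by move=> x Kx; split; [exact: UK | exact: VK].
- by move=> L LUV; split=> x /LUV [].
Qed.

End UpperVietoris.

HB.instance Definition _ (X : topologicalType) :=
  Choice.on (smyth_power_space X).
HB.instance Definition _ (X : topologicalType) :=
  isBaseTopological.Build (smyth_power_space X) (@box_cover X) (@box_join X).

Definition scott_power_space (X : topologicalType) : topologicalType :=
  scott_space (compact_saturated X).

(* O(P_S(X)) is included in sigma(K(X)); both are families of subsets of the
   same type [compact_saturated X]. *)
Definition upper_vietoris_coarser_than_scott (X : topologicalType) : Prop :=
  forall W : set (compact_saturated X),
    open (W : set (smyth_power_space X)) ->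
    open (W : set (scott_power_space X)).

Definition filtered_family (X : topologicalType)
    (F : set (compact_saturated X)) : Prop :=
  F !=set0 /\
  forall K L, F K -> F L ->
    exists M, [/\ F M, (M : set X) `<=` K & (M : set X) `<=` L].

Definition well_filtered (X : topologicalType) : Prop :=
  kolmogorov_space X /\
  forall (F : set (compact_saturated X)) (U : set X),
    filtered_family F -> open U ->
    \bigcap_(K in F) (K : set X) `<=` U ->
    exists2 K, F K & (K : set X) `<=` U.

(* Main.v *)
Require Import Defs.
From HB Require Import structures.
From mathcomp Require Import all_boot all_order.
From mathcomp Require Import all_classical.
From mathcomp Require Import topology.

(** Three of the four implications are short.  A well-filtered space is a
    d-space: for a directed set D, well-filteredness applied to the compact
    sets generated by the points of D, and to the complement of the closure of
    D, yields an upper bound of D lying in the closure of D, and such a point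
    is the supremum of D and has no open neighborhood missing D
    ([well_filtered_d_space]).  The specialization order of a Scott space is
    the original order, so a Scott d-space comes from a dcpo
    ([d_space_scott_dcpo]).  If K(X) is a dcpo whose Scott topology contains
    the sets [box U], a filtered family has a supremum, which is contained in
    the intersection; if the intersection lies in U then the supremum is in
    [box U], hence so is a member of the family
    ([dcpo_coarser_well_filtered]).

    The substance is that well-filteredness passes from X to the Scott power
    space.  When X is well-filtered, filtered intersections of nonempty compact
    saturated sets are again such sets, and they are exactly the directed
    suprema of K(X); this already makes every [box U] Scott open.  Now let F be
    a filtered family of compact saturated sets of the Scott space of K(X),
    with intersection in an open U, and suppose that no member of F lies in U.
    Enlarge U to an open M maximal among those containing no member of F
    ([topological_rudin]); its complement A is a minimal closed set meeting
    all members.  For Q in F, let C(Q) be the union of the elements of Q that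
    belong to A.  It is compact, because Q is compact and each [box V] is Scott
    open, and it is an element of K(X) below the elements of Q that lie in A,
    hence in A.  As A is closed under directed suprema, the intersection K of
    all C(Q) is in A.  Each point x of K lies in an element of A from each Q, so the elements of A
    that contain x form a closed set that still meets all members of F; by
    minimality every element of A contains x.  Hence K is contained in every
    element of A, that is, it is above all of them in the Smyth order; each Q
    being an upper set, K is in every Q, hence in U, hence in M: a
    contradiction. *)

Set Implicit Arguments.
Unset Strict Implicit.
Unset Printing Implicit Defensive.

Import Order.TTheory.

Local Open Scope order_scope.
Local Open Scope classical_set_scope.

(** * Compactness through directed open covers *)

Definition directed_cover (T : topologicalType) (V : set (set T)) : Prop :=
  [/\ V !=set0, V `<=` open &
      forall A B, V A -> V B -> exists C, [/\ V C, A `<=` C & B `<=` C]].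

(** For a directed cover a finite subcover amounts to one member, so that
    compactness can be used and proved without handling finite sets.  If no
    member of V contains A, the traces on A of the complements of the members
    generate a filter without cluster point in A.  Conversely, if F has no
    cluster point in A, the open sets whose complement belongs to F form a
    directed cover of A. *)
Lemma compact_directed_coverP (T : topologicalType) (A : set T) :
  compact A <->
  forall V, directed_cover V -> A `<=` \bigcup_(B in V) B ->
    exists2 B, V B & A `<=` B.
Proof.
split=> [cA V [[B0 VB0] oV dV] AV|cA F PF FA].
  apply: contrapT => noB.
  have fF : Filter (filter_from V (fun B => A `\` B)).
    apply: filter_from_filter; first by exists B0.
    move=> B C VB VC; have [D [VD BD CD]] := dV _ _ VB VC.
    by exists D => // x [Ax nDx]; split; split=> //; [move=> /BD | move=> /CD].
  have pF : ProperFilter (filter_from V (fun B => A `\` B)).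
    apply: filter_from_proper => B VB; apply/set0P/negP => /eqP AB0.
    apply: noB; exists B => // x Ax; apply: contrapT => nBx.
    by have : (A `\` B) x by []; rewrite AB0.
  have [|x [Ax clx]] := cA _ pF; first by exists B0 => // x [].
  have [B VB Bx] := AV x Ax.
  have [||y [[_ nBy] By]] := clx (A `\` B) B; first by exists B.
    by apply: open_nbhs_nbhs; split=> //; exact: oV.
  exact: nBy.
apply/set0P/negP => /eqP noclust.
have [| |B [oB FnB] AB] := cA [set B | open B /\ F (~` B)].
- split.
  + by exists set0; split; [exact: open0 | apply: filterS filterT => x _ []].
  + by move=> B [].
  + move=> B C [oB FB] [oC FC]; exists (B `|` C); split.
    * by split; [exact: openU | apply: filterS (filterI FB FC) => x [nBx nCx] []].
    * exact: subsetUl.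
    * exact: subsetUr.
- move=> x Ax; apply: contrapT => ncov.
  suff : (A `&` cluster F) x by rewrite noclust.
  split=> // B N FB; rewrite nbhsE => -[U [oU Ux] UN].
  apply: contrapT => BN; apply: ncov; exists U => //; split=> //.
  apply: filterS FB => y By Uy; apply: BN; exists y; split=> //; exact: UN.
- suff : F set0 by exact: filter_not_empty.
  by apply: filterS (filterI FA FnB) => x [/AB Bx].
Qed.

(** * Saturated sets and the specialization order *)

Lemma closure1P (T : topologicalType) (x y : T) :
  closure [set y] x <-> forall U, open U -> U x -> U y.
Proof.
split=> [xy U oU Ux|xy B].
  by have [|_ [-> ]] := xy U; first exact: open_nbhs_nbhs.
by rewrite nbhsE => -[U [oU Ux] UB]; exists y; split=> //; apply: UB; exact: xy.
Qed.

(** From right to left, if y is not in the upper set A, the complement of the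
    closure of y is an open set that contains A and misses y. *)
Lemma saturatedP (T : topologicalType) (A : set T) :
  saturated A <-> forall x y, closure [set y] x -> A x -> A y.
Proof.
split=> [-> x y /closure1P xy Ax U [oU AU]|upA].
  by apply: xy => //; exact: Ax.
apply/seteqP; split=> [x Ax U [_]|y yA]; first exact.
apply: contrapT => nAy.
apply: (yA (~` closure [set y])); last exact: subset_closure.
split; first by apply: closed_openC; exact: closed_closure.
by move=> x Ax xy; apply: nAy; exact: upA xy Ax.
Qed.


(** The principal upper set of x for the specialization order, which is written
    through closures so that it makes sense without the T0 axiom. *)
Definition up (T : topologicalType) (x : T) : set T :=
  [set y | closure [set y] x].

Lemma up_refl (T : topologicalType) (x : T) : up x x.
Proof. exact: subset_closure. Qed.

Lemma up_compact (T : topologicalType) (x : T) : compact (up x).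
Proof.
apply/compact_directed_coverP => V [_ oV _] /(_ x (@up_refl _ x)) [B VB Bx].
by exists B => // y /closure1P; apply => //; exact: oV.
Qed.

Lemma up_saturated (T : topologicalType) (x : T) : saturated (up x).
Proof.
apply/saturatedP => y z /closure1P yz /closure1P xy.
by apply/closure1P => U oU /(xy _ oU) /(yz _ oU).
Qed.

Definition cs_up (T : topologicalType) (x : T) : compact_saturated T :=
  CompactSaturated (ex_intro _ x (@up_refl T x)) (@up_compact T x)
    (@up_saturated T x).

Lemma cs_upP (T : topologicalType) (K : compact_saturated T) (x : T) :
  (K : set T) x <-> up x `<=` K.
Proof.
split=> [Kx y xy|]; last by apply; exact: up_refl.
exact: (iffLR (saturatedP K) (@cs_saturated _ K)) xy Kx.
Qed.

(** * Compact saturated sets of a well-filtered space *)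

Lemma smyth_leP (T : topologicalType) (K L : compact_saturated T) :
  reflect ((L : set T) `<=` K) (K <= L).
Proof. exact: asboolP. Qed.

Lemma directed_smythP (T : topologicalType) (F : set (compact_saturated T)) :
  directed F <-> filtered_family F.
Proof.
split=> -[F0 dF]; split=> // K L FK FL; have [M] := dF K L FK FL.
  by move=> [FM /smyth_leP KM /smyth_leP LM]; exists M.
by move=> [FM KM LM]; exists M; split=> //; exact/smyth_leP.
Qed.

Section WellFiltered.
Context {T : topologicalType} (wfT : well_filtered T).

(** Nonemptiness is well-filteredness for the empty open set; for compactness,
    if a directed family of open sets covers the intersection, its union
    contains some compact member of F, which one of the open sets contains. *)
Lemma well_filtered_bigcap (F : set (compact_saturated T)) :
  filtered_family F ->
  exists L : compact_saturated T, L = \bigcap_(K in F) (K : set T) :> set T.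
Proof.
move=> fF.
have ne : \bigcap_(K in F) (K : set T) !=set0.
  apply/set0P/negP => /eqP F0.
  have [|K FK] := wfT.2 F set0 fF (@open0 _); first by rewrite F0.
  by have [x Kx] := cs_nonempty K => /(_ x Kx).
have cF : compact (\bigcap_(K in F) (K : set T)).
  apply/compact_directed_coverP => V dV FV.
  have oV : open (\bigcup_(B in V) B).
    by case: dV => _ oV _; apply: bigcup_open => B /oV.
  have [K FK KV] := wfT.2 F _ fF oV FV.
  have [B VB KB] := iffLR (compact_directed_coverP K) (@cs_compact _ K) V dV KV.
  by exists B => // x Fx; apply/KB/Fx.
have sF : saturated (\bigcap_(K in F) (K : set T)).
  apply/saturatedP => x y xy Fx K FK.
  by apply: (iffLR (saturatedP K) (@cs_saturated _ K) _ _ xy); exact: Fx.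
by exists (CompactSaturated ne cF sF).
Qed.

(** The intersection is always the least upper bound for reverse inclusion, as
    soon as it belongs to K(T). *)
Lemma well_filtered_supremums (F : set (compact_saturated T))
    (s : compact_saturated T) :
  filtered_family F ->
  supremums F s <-> s = \bigcap_(K in F) (K : set T) :> set T.
Proof.
move=> fF; have [L LF] := well_filtered_bigcap fF.
have supL : supremums F L.
  split=> [K FK|M uM]; apply/smyth_leP; rewrite LF => x; first exact.
  by move=> Mx K FK; have /smyth_leP := uM K FK; apply.
split=> [sups|sF]; last by have -> : s = L by apply: cs_inj; rewrite sF LF.
rewrite -LF; congr cs_set; apply/eqP; rewrite eq_le.
by rewrite (sups.2 _ supL.1) (supL.2 _ sups.1).
Qed.

Lemma well_filtered_coarser : upper_vietoris_coarser_than_scott T.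
Proof.
move=> W [D Dopen <-]; rewrite /= open_scottE; split.
  move=> K L /smyth_leP KL [U DU UK]; exists U => //.
  exact: subset_trans KL UK.
move=> F s /directed_smythP fF /(well_filtered_supremums _ fF) sF [U DU Us].
have [|K FK KU] := wfT.2 F U fF (Dopen _ DU); first by rewrite -sF.
by exists K; split=> //; exists U.
Qed.

End WellFiltered.

(** * Topology of the power spaces *)

Lemma open_box (T : topologicalType) (U : set T) :
  open U -> open (box U : set (smyth_power_space T)).
Proof.
by move=> oU; exists [set U] => [_ -> //|]; rewrite bigcup_set1.
Qed.

(** Principal ideals are Scott closed: an upper bound s of a directed set is
    above its supremum. *)
Lemma open_not_le d (P : porderType d) (s : P) :
  open ([set x | ~ x <= s] : set (scott_space P)).
Proof.
rewrite open_scottE; split=> [x y xy /= nx ys|D t _ [_ lt] /= nt].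
  by apply: nx; exact: le_trans ys.
apply: contrapT => DU; apply: nt; apply: lt => x Dx; apply: contrapT => nx.
by apply: DU; exists x.
Qed.

Lemma scott_closure1 d (P : porderType d) (x y : P) :
  closure [set (y : scott_space P)] (x : scott_space P) <-> x <= y.
Proof.
rewrite closure1P; split=> [xy|xy U oU Ux].
  by apply: contrapT => nxy; have := xy _ (@open_not_le d P y) nxy; apply.
by have [uU _] := oU; exact: uU Ux.
Qed.

Lemma scott_kolmogorov d (P : porderType d) : kolmogorov_space (scott_space P).
Proof.
move=> x y xy.
have [xley|nxy] := boolP ((x : P) <= y).
  exists [set z | ~ (z : P) <= x]; right; split; rewrite inE /=; last first.
    by apply; exact: lexx.
  apply: open_nbhs_nbhs; split; first exact: open_not_le.
  by move=> /= yx; move/eqP: xy; apply; apply/le_anti; rewrite xley.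
exists [set z | ~ (z : P) <= y]; left; split; rewrite inE /=; last first.
  by apply; exact: lexx.
by apply: open_nbhs_nbhs; split; [exact: open_not_le | exact/negP].
Qed.

(** * Well-filteredness of the Scott power space *)

(** Rudin's lemma in topological form, stated for open sets instead of their
    complements: the complement of M is minimal among the closed sets that are
    disjoint from U and meet every member of F.  Zorn's lemma applies since a
    compact set contained in the union of a chain of open sets is contained in
    one of them. *)
Lemma topological_rudin (T : topologicalType) (F : set (set T)) (U : set T) :
  (forall K, F K -> compact K) -> open U -> (forall K, F K -> ~ K `<=` U) ->
  exists M, [/\ open M, U `<=` M, forall K, F K -> ~ K `<=` M &
    forall V, open V -> M `<=` V -> V `<=` M \/ exists2 K, F K & K `<=` V].
Proof.
move=> cF oU FU.
pose P := [set V | open V /\ forall K, F K -> ~ K `<=` U `|` V].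
have [C CP totC|M [[oM FM] maxM]] := @Zorn_bigcup T P.
  split=> [|K FK KV]; first by apply: bigcup_open => V /CP [].
  (* The empty set is added to keep the cover nonempty for the empty chain. *)
  have [||_ [V CV <-]] := iffLR (compact_directed_coverP K) (cF K FK)
      [set U `|` V | V in C `|` [set set0]].
  - split.
    + by exists (U `|` set0); exists set0 => //; right.
    + move=> _ [V CV <-]; apply: openU => //.
      by case: CV => [/CP []|->] //; exact: open0.
    + move=> _ _ [V CV <-] [W CW <-].
      have [VW|WV] : V `<=` W \/ W `<=` V.
        case: CV CW => [CV|->] [CW|->]; try by [left|right].
        exact: totC.
      * by exists (U `|` W); split=> //; [exists W | exact: setUS].
      * by exists (U `|` V); split=> //; [exists V | exact: setUS].
  - move=> x /KV [Ux|[V CV Vx]].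
      by exists (U `|` set0); [exists set0 => //; right | left].
    by exists (U `|` V); [exists V => //; left | right].
  case: CV => [/CP [_ nV] /(nV _ FK) //|->]; rewrite setU0; exact: FU.
exists (U `|` M); split=> //; first exact: openU.
move=> V oV UMV; have [VM|nVM] := pselect (V `<=` M).
  by left; right; exact: VM.
right; apply: contrapT => nK; apply: (maxM V).
  by split=> // x Mx; apply: UMV; right.
split=> // K FK; rewrite setUidr => [KV|x Ux]; last by apply: UMV; left.
by apply: nK; exists K.
Qed.

(** Minimality is applied to the closed set of the elements outside M that
    contain a given point x: it is the complement of M intersected with the
    principal ideal of [cs_up x], which is Scott closed. *)
Lemma well_filtered_scott_power (T : topologicalType) :
  well_filtered T -> well_filtered (scott_power_space T).
Proof.
move=> wfT; split; first exact: scott_kolmogorov.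
move=> F U fF oU FU; apply: contrapT => noK.
have [|//|_ [Q FQ <-] QU|M [oM UM FM maxM]] := @topological_rudin
    (scott_power_space T) [set (Q : set (scott_power_space T)) | Q in F] U.
- by move=> _ [Q _ <-]; exact: cs_compact.
- by apply: noK; exists Q.
have [upM scM] := oM.
(* [C Q] is the infimum in K(T) of the part of Q outside M, hence it is itself
   outside M. *)
pose C (Q : compact_saturated (scott_power_space T)) : set T :=
  \bigcup_(G in (Q : set (scott_power_space T)) `\` M)
    ((G : compact_saturated T) : set T).
have QM Q : F Q -> exists G : compact_saturated T,
    (Q : set (scott_power_space T)) G /\ ~ M G.
  move=> FQ; apply: contrapT => nG; apply: (FM Q); first by exists Q.
  by move=> G QG; apply: contrapT => nMG; apply: nG; exists G.
have csC Q : F Q -> exists L : compact_saturated T, L = C Q :> set T.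
  move=> FQ; have [G [QG nMG]] := QM Q FQ.
  have neC : C Q !=set0.
    by have [x Gx] := cs_nonempty G; exists x, G.
  have sC : saturated (C Q).
    apply/saturatedP => x y xy [H QH Hx]; exists H => //.
    exact: (iffLR (saturatedP _) (@cs_saturated _ H)) xy Hx.
  have cC : compact (C Q).
    apply/compact_directed_coverP => V dV CV; have [[B0 VB0] oV VV] := dV.
    have [||_ [B VB <-] QB] := iffLR (compact_directed_coverP _)
      (@cs_compact _ Q) [set M `|` box B | B in V].
    + split.
      * by exists (M `|` box B0), B0.
      * move=> _ [B VB <-]; apply: openU => //.
        by apply: well_filtered_coarser => //; apply: open_box; exact: oV.
      * move=> _ _ [A VA <-] [B VB <-]; have [D [VD AD BD]] := VV A B VA VB.
        exists (M `|` box D); split; first by exists D.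
        - by apply: setUS => H /= HA; exact: subset_trans HA AD.
        - by apply: setUS => H /= HB; exact: subset_trans HB BD.
    + move=> H QH; have [MH|nMH] := pselect (M H).
        by exists (M `|` box B0); [exists B0 | left].
      have [|B VB HB] := iffLR (compact_directed_coverP _)
        (@cs_compact _ (H : compact_saturated T)) V dV.
        by move=> x Hx; apply: CV; exists H.
      by exists (M `|` box B); [exists B | right].
    + by exists B => // x [H [/QB [//|HB] _]]; exact: HB.
  by exists (CompactSaturated neC cC sC).
pose D := [set L : compact_saturated T | exists2 Q, F Q & L = C Q :> set T].
have fD : filtered_family D.
  split.
    by have [[Q FQ] _] := fF; have [L LC] := csC Q FQ; exists L, Q.
  move=> K L [Q FQ KQ] [R FR LR]; have [S [FS SQ SR]] := fF.2 Q R FQ FR.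
  have [N NS] := csC S FS; exists N; split; first by exists S.
    by rewrite NS KQ => x [H [/SQ QH nMH] Hx]; exists H.
  by rewrite NS LR => x [H [/SR RH nMH] Hx]; exists H.
have [K KD] := well_filtered_bigcap wfT fD.
(* K is the directed supremum of the [C Q], none of which is in the open M. *)
have nMK : ~ M K.
  move=> MK; have [||L [[Q FQ LQ] ML]] := scM D K _ _ MK.
  - exact/directed_smythP.
  - exact/well_filtered_supremums.
  have [G [QG nMG]] := QM Q FQ; apply: (nMG); apply: upM ML.
  by apply/smyth_leP; rewrite LQ => x Gx; exists G.
(* By minimality of the complement of M, K is above all of its elements. *)
have Kmin G : ~ M G -> (K : set T) `<=` (G : compact_saturated T).
  move=> nMG x Kx.
  pose V : set (scott_power_space T) :=
    M `|` [set H : compact_saturated T | ~ H <= cs_up x].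
  have [||VM|[_ [Q FQ <-] QV]] := maxM V.
  - by apply: openU => //; exact: (@open_not_le _ (compact_saturated T)).
  - by move=> H; left.
  - apply: contrapT => nGx; apply/nMG/VM; right => /smyth_leP.
    by move=> /cs_upP.
  - have [L LQ] := csC Q FQ.
    have : C Q x by rewrite -LQ; move: Kx; rewrite KD; apply; exists Q.
    move=> [H [/QV [//|] + nMH] /cs_upP Hx].
    by move=> /= nH; exfalso; apply: nH; exact/smyth_leP.
apply/nMK/UM/FU => Q FQ; have [G [QG nMG]] := QM Q FQ.
apply: (iffLR (saturatedP _) (@cs_saturated _ Q) G K) => //.
by apply/scott_closure1/smyth_leP; exact: Kmin.
Qed.

(** * The equivalence *)

Lemma spec_leE (T : topologicalType) (T0 : kolmogorov_space T)
    (x y : specialization T0) :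
  x <= y <-> closure [set (y : T)] (x : T).
Proof. by split=> /asboolP. Qed.

(** A point s of the closure of D that is an upper bound of D is its supremum,
    since every upper bound u satisfies D `<=` closure [set u]; and an open set
    that contains s meets D. *)
Lemma well_filtered_d_space (T : topologicalType) :
  well_filtered T -> d_space T.
Proof.
move=> wfT; exists wfT.1.
have clD (D : set (specialization wfT.1)) : directed D ->
    exists2 s, supremums D s & closure (D : set T) s.
  move=> [[d0 Dd0] dD].
  pose F := [set cs_up (d : T) | d in (D : set T)].
  have fF : filtered_family F.
    split; first by exists (cs_up (d0 : T)); exists d0.
    move=> _ _ [x Dx <-] [y Dy <-]; have [z [Dz xz yz]] := dD x y Dx Dy.
    by exists (cs_up (z : T)); split; first (by exists z);
      apply/cs_upP/spec_leE.
  have [s [Fs clDs]] : (\bigcap_(K in F) (K : set T)) `&` closure D !=set0.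
    apply/set0P/negP => /eqP F0.
    have [||_ [d Dd <-]] := wfT.2 F (~` closure D) fF.
    - by apply: closed_openC; exact: closed_closure.
    - by move=> x Fx clx; rewrite -[False]/(set0 x) -F0.
    - by move=> /(_ d (@up_refl T d)); apply; exact: subset_closure.
  exists s => //; split=> [d Dd|u uD].
    by apply/spec_leE; apply: (Fs (cs_up (d : T))); exists d.
  apply/spec_leE; have /closure_id -> := @closed_closure T [set (u : T)].
  move: clDs; apply: closureS.
  by move=> d Dd; apply/spec_leE; exact: uD.
split=> [D /clD [s sD _]|U oU]; first by exists s.
split=> [x y /spec_leE /closure1P|D s dD sD Us]; first exact.
have [t tD clt] := clD D dD.
have st : s = t by apply/le_anti; rewrite (sD.2 _ tD.1) (tD.2 _ sD.1).
by apply: clt; apply: open_nbhs_nbhs; split=> //; rewrite -st.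
Qed.

Lemma d_space_scott_dcpo d (P : porderType d) :
  d_space (scott_space P) -> dcpo P.
Proof.
move=> [T0 [dcS _]] D [D0 dD].
have leE (x y : P) : ((x : specialization T0) <= y) <-> (x <= y).
  by rewrite spec_leE; exact: scott_closure1.
have [|s [us ls]] := dcS D.
  split=> // x y Dx Dy; have [z [Dz xz yz]] := dD x y Dx Dy.
  by exists z; split=> //; exact/leE.
exists s; split=> [x Dx|u uD]; first by apply/leE; exact: us.
by apply/leE; apply: ls => x Dx; apply/leE; exact: uD.
Qed.

Lemma dcpo_coarser_well_filtered (T : topologicalType) :
  kolmogorov_space T -> dcpo (compact_saturated T) ->
  upper_vietoris_coarser_than_scott T -> well_filtered T.
Proof.
move=> T0 dcT coT; split=> // F U fF oU FU.
have dF : directed F by exact/directed_smythP.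
have [s sF] := dcT F dF; have [_ scU] := coT _ (open_box oU).
have [|K [FK KU]] := scU F s dF sF; last by exists K.
apply: subset_trans FU => x sx K FK.
by have /smyth_leP := sF.1 K FK; apply.
Qed.

Theorem corollary6p10 (X : topologicalType) (X0 : kolmogorov_space X) :
  [<-> well_filtered X;
       upper_vietoris_coarser_than_scott X /\
         well_filtered (scott_power_space X);
       upper_vietoris_coarser_than_scott X /\ d_space (scott_power_space X);
       dcpo (compact_saturated X) /\ upper_vietoris_coarser_than_scott X].
Proof.
tfae.
- move=> wfX; split; first exact: well_filtered_coarser.
  exact: well_filtered_scott_power.
- by move=> [coX /well_filtered_d_space].
- by move=> [coX /d_space_scott_dcpo].
- by move=> [dcX]; exact: dcpo_coarser_well_filtered.
Qed.
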